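(* Let $p_1,\dots,p_n$ be distinct primes and $N=p_1^{\alpha_1}\cdots p_n^{\alpha_n}$ with $\alpha_1\ge \alpha_2\ge\cdots\ge \alpha_u>\alpha_{u+1}=\cdots =\alpha_n=1$ (where $u=0$ if all $\alpha_i=1$). Let $\mathcal T_1,\ldots,\mathcal T_k$ be all the sets $\mathcal T$ of positive divisors of $p_{u+1}\cdots p_n$ such that: (a) no two elements of $\mathcal T$ are coprime; (b) no element of $\mathcal T$ is divisible by another element of $\mathcal T$; (c) every divisor of $p_{u+1}\cdots p_n$ is either coprime to some element of $\mathcal T$ or divisible by some element of $\mathcal T$. Then $R(\mathcal T_1,N),\ldots,R(\mathcal T_k,N)$ are all the maximal $N$-sets with the minimum size; that is, a set of positive divisors of $N$ is a maximal $N$-set with the minimum size if and only if it equals $R(\mathcal T_i,N)$ for some $1\le i\le k$.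
   Context: A set $\mathcal D$ of positive divisors of $N$ is an $N$-set if no two elements of $\mathcal D$ are coprime; an $N$-set is maximal if no additional positive divisor of $N$ can be included in it while keeping the $N$-set property. ''Maximal $N$-set with the minimum size'' means a maximal $N$-set whose cardinality is the minimum of the cardinalities of all maximal $N$-sets (this minimum is known to equal $\alpha_n\prod_{i=1}^{n-1}(\alpha_i+1)$). For a set $\mathcal T$ of positive divisors of $N$, $R(\mathcal T,N)$ denotes the set of all positive divisors of $N$ that are divisible by at least one element of $\mathcal T$. *)

(* Defs.v *)
From mathcomp Require Import all_boot.
From mathcomp Require Import finmap.

Set Implicit Arguments.
Unset Strict Implicit.
Unset Printing Implicit Defensive.

Local Open Scope fset_scope.

(* The two elements may be equal: as coprime 1 1 holds, this says that 1 is
   not in D and that distinct elements of D are not coprime. *)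
Definition no_two_coprime (D : {fset nat}) : Prop :=
  {in D &, forall x y, ~~ coprime x y}.

Definition is_Nset (N : nat) (D : {fset nat}) : Prop :=
  {subset D <= divisors N} /\ no_two_coprime D.

Definition maximal_Nset (N : nat) (D : {fset nat}) : Prop :=
  is_Nset N D /\
  (forall d : nat, d \in divisors N -> d \notin D -> ~ is_Nset N (d |` D)).

Definition min_size_maximal_Nset (N : nat) (D : {fset nat}) : Prop :=
  maximal_Nset N D /\
  (forall E : {fset nat}, maximal_Nset N E -> #|` D| <= #|` E|).

Definition R (T : {fset nat}) (N : nat) : {fset nat} :=
  [fset d in divisors N | has (fun t => t %| d) T].

Definition generating_set (M : nat) (T : {fset nat}) : Prop :=
  [/\ {subset T <= divisors M},
      no_two_coprime T,
      {in T &, forall x y, x != y -> ~~ (x %| y)} &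
      forall d : nat, d \in divisors M ->
        (exists2 t, t \in T & coprime d t) \/ (exists2 t, t \in T & t %| d)].

(* Main.v *)
Require Import Defs.
From mathcomp Require Import all_boot.
From mathcomp Require Import finmap.

(** Whether two divisors of N are coprime depends only on their supports (the
    sets of primes dividing them), so the maximal N-sets are the preimages of
    the self-dual upsets F of supports, and such a preimage has size
    w(F) = sum over A in F of prod_(i in A) alpha_i.

    Exchanging the weights of presence and absence of one prime p_i cannot
    increase the mass of an upset, and strictly decreases it when alpha_i > 1
    unless F is invariant under adding and removing p_i.  After all exchanges
    the mass is that of the complements of the members of F, that is, by
    self-duality, of the non-members.  Hence w(F) is at least half the number
    of divisors of N, with equality exactly when F is determined by the primes
    of exponent 1.  The generating sets T are the antichains of minimal
    elements of these F. *)

Set Implicit Arguments.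
Unset Strict Implicit.
Unset Printing Implicit Defensive.

(** * Masses of upsets under the exchange of presence and absence *)

Section WeightedUpsets.

Variables (I : finType) (a : I -> nat).
Hypothesis a_gt0 : forall i, 0 < a i.

Implicit Types (i j : I) (A B S : {set I}) (F : {set {set I}}).

Definition toggle i A : {set I} := [set j | (j \in A) (+) (j == i)].

Definition upset F := forall A B, A \in F -> A \subset B -> B \in F.

(** Together with [upset] this makes [F] a maximal intersecting family. *)
Definition self_dual F := forall A, (~: A \in F) = (A \notin F).

Definition toggle_closed F i := forall A, A \in F -> toggle i A \in F.

(* The coordinates in [S] have the roles of presence and absence exchanged, so
   [weight set0] is the product over [A] and [weight setT] the product over
   the complement of [A]. *)
Definition weight S A := \prod_j a j ^ ((j \in A) (+) (j \in S)).

Definition mass S F := \sum_(A in F) weight S A.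

Lemma toggleK i : involutive (toggle i).
Proof. by move=> A; apply/setP => j; rewrite !inE -addbA addbb addbF. Qed.

Lemma in_toggle i A : (i \in toggle i A) = (i \notin A).
Proof. by rewrite inE eqxx addbT. Qed.

Lemma toggle_in i A : i \in A -> toggle i A = A :\ i.
Proof.
move=> iA; apply/setP => j; rewrite !inE.
by case: eqP => [->|_]; rewrite ?iA ?addbF.
Qed.

Lemma toggle_notin i A : i \notin A -> toggle i A = i |: A.
Proof.
move=> iA; apply/setP => j; rewrite !inE.
by case: eqP => [->|_]; rewrite ?(negPf iA) ?addbF.
Qed.

Lemma weight_toggle i S A : weight (toggle i S) A = weight S (toggle i A).
Proof. by apply: eq_bigr => j _; rewrite !inE addbA addbAC. Qed.

Lemma weight_gt0 S A : 0 < weight S A.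
Proof. by apply: prodn_gt0 => i; rewrite expn_gt0 a_gt0. Qed.

Lemma weight_toggle_in i S A : i \in A -> i \notin S ->
  weight S A = a i * weight S (toggle i A).
Proof.
move=> iA iS; rewrite /weight (bigD1 i) //= iA (negPf iS) expn1; congr (_ * _).
rewrite [RHS](bigD1 i) //= in_toggle iA (negPf iS) mul1n.
by apply: eq_bigr => j /negPf ji; rewrite inE ji addbF.
Qed.

Lemma weight_toggle1 i S A : a i = 1 -> weight S (toggle i A) = weight S A.
Proof.
move=> ai; apply: eq_bigr => j _; rewrite inE.
by case: eqP => [->|]; rewrite ?ai ?exp1n ?addbF.
Qed.

Lemma mass_split i S F : mass S F =
  \sum_(A in F | toggle i A \in F) weight S A +
  \sum_(A in F | toggle i A \notin F) weight S A.
Proof. by rewrite /mass (bigID (fun A => toggle i A \in F)). Qed.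

(** Toggling [i] permutes the members whose toggle is also in [F], so their total weight survives
    the exchange; only the unpaired members can change the mass. *)
Lemma mass_split_toggle i S F : mass (toggle i S) F =
  \sum_(A in F | toggle i A \in F) weight S A +
  \sum_(A in F | toggle i A \notin F) weight S (toggle i A).
Proof.
rewrite (mass_split i); congr (_ + _); last first.
  by apply: eq_bigr => A _; rewrite weight_toggle.
rewrite (reindex_inj (inv_inj (toggleK i))) /=.
by apply: eq_big => [A|A _]; rewrite ?weight_toggle toggleK // andbC.
Qed.

Lemma upset_toggle_in F i A : upset F -> A \in F -> toggle i A \notin F ->
  i \in A.
Proof.
move=> upF AF; apply: contraNT => iA.
by apply: upF AF _; rewrite toggle_notin // subsetU1.
Qed.

(** In an upset every unpaired member contains [i], so the exchange removes a factor [a i] from its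
    weight. *)
Lemma mass_toggle_le F i S : upset F -> i \notin S ->
  mass (toggle i S) F <= mass S F.
Proof.
move=> upF iS; rewrite mass_split_toggle (mass_split i) leq_add2l.
apply: leq_sum => A /andP[AF tAF].
by rewrite (weight_toggle_in (upset_toggle_in upF AF tAF) iS) leq_pmull.
Qed.

Lemma mass_toggle_lt F i S A : upset F -> i \notin S -> 1 < a i ->
  A \in F -> toggle i A \notin F -> mass (toggle i S) F < mass S F.
Proof.
move=> upF iS ai AF tAF; rewrite mass_split_toggle (mass_split i) ltn_add2l.
have PA : (A \in F) && (toggle i A \notin F) by rewrite AF.
rewrite (bigD1 A) // [X in _ < X](bigD1 A) //= -addSn.
apply: leq_add.
  rewrite (weight_toggle_in (upset_toggle_in upF AF tAF) iS).
  by rewrite ltn_Pmull ?weight_gt0.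
apply: leq_sum => B /andP[/andP[BF tBF] _].
by rewrite (weight_toggle_in (upset_toggle_in upF BF tBF) iS) leq_pmull.
Qed.

(** Either no member is unpaired, or [a i = 1] and the weights ignore [i]. *)
Lemma mass_toggle_eq F i S : (1 < a i -> toggle_closed F i) ->
  mass (toggle i S) F = mass S F.
Proof.
move=> closedF; rewrite mass_split_toggle (mass_split i); congr (_ + _).
have [/closedF tF|] := boolP (1 < a i).
  by rewrite !big_pred0 // => A; apply/negP => /andP[/tF ->].
rewrite -leqNgt => ai; apply: eq_bigr => A _; apply: weight_toggle1.
by apply/eqP; rewrite eqn_leq ai a_gt0.
Qed.

Lemma mass_sub_le F S S' : upset F -> S' \subset S -> mass S F <= mass S' F.
Proof.
move=> upF; move: {2}#|S| (leqnn #|S|) => m.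
elim: m S => [|m IH] S leSm sS.
  move: leSm; rewrite leqn0 cards_eq0 => /eqP S0.
  by move: sS; rewrite S0 subset0 => /eqP ->.
have [-> //|neq] := eqVneq S' S.
have /properP[_ [i iS iS']] : S' \proper S by rewrite properEneq neq.
apply: leq_trans (IH (S :\ i) _ _).
- rewrite -{1}(toggleK i S) (toggle_in iS); apply: mass_toggle_le => //.
  by rewrite !inE eqxx.
- by move: leSm; rewrite (cardsD1 i) iS.
- by rewrite subsetD1 sS.
Qed.

(** Complementation carries the non-members onto the members and turns [weight set0] into
    [weight setT]. *)
Lemma mass_self_dual F : self_dual F ->
  mass set0 setT = mass set0 F + mass setT F.
Proof.
move=> dualF; rewrite {1}/mass (bigID (mem F)) /=; congr (_ + _).
  by apply: eq_bigl => A; rewrite inE.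
rewrite (reindex_inj (inv_inj (@setCK I))) /=; apply: eq_big => A.
  by rewrite inE dualF negbK.
by move=> _; apply: eq_bigr => i _; rewrite !inE addbF addbT.
Qed.

Lemma mass_ge_half F : upset F -> self_dual F ->
  mass set0 setT <= 2 * mass set0 F.
Proof.
move=> upF /mass_self_dual ->.
by rewrite mul2n -addnn leq_add2l mass_sub_le ?sub0set.
Qed.

Lemma mass_eq_half F : upset F -> self_dual F ->
  mass set0 setT = 2 * mass set0 F <->
  (forall i, 1 < a i -> toggle_closed F i).
Proof.
move=> upF /mass_self_dual ->; rewrite mul2n -addnn; split.
  move=> /addnI eqF i ai A AF; apply/idPn => tAF.
  have i0 : i \notin set0 by rewrite inE.
  (* Exchanging [i] first would lose mass strictly, and the remaining exchanges up to [setT] cannot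
     regain it. *)
  have := mass_toggle_lt upF i0 ai AF tAF.
  by rewrite toggle_notin // ltnNge -eqF mass_sub_le ?subsetT.
move=> closedF; congr (_ + _).
have: forall m S, #|S| <= m -> mass S F = mass set0 F.
  elim=> [|m IH] S.
    by rewrite leqn0 cards_eq0 => /eqP ->.
  have [-> //|[i iS]] := set_0Vmem S.
  rewrite (cardsD1 i) iS => /IH <-.
  by rewrite -(toggle_in iS) mass_toggle_eq //; apply: closedF.
by move/(_ _ _ (leqnn _)).
Qed.

End WeightedUpsets.

Lemma logn_prod (I : finType) (q : nat) (G : I -> nat) :
  (forall i, 0 < G i) -> logn q (\prod_i G i) = \sum_i logn q (G i).
Proof.
move=> G_gt0.
(* Positivity is carried through the induction because [lognM] needs positive factors. *)
suff [] : logn q (\prod_i G i) = \sum_i logn q (G i) /\ 0 < \prod_i G i by [].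
elim/big_ind2: _ => [|x1 x2 y1 y2 [<- x_gt0] [<- y_gt0]|i _] //.
  by rewrite logn1.
by rewrite lognM // muln_gt0 x_gt0.
Qed.

(** * Divisors of [N], their exponents and their supports *)

Section Supports.

Variables (I : finType) (p a : I -> nat).
Hypotheses (p_prime : forall i, prime (p i)) (p_inj : injective p).
Hypothesis a_gt0 : forall i, 0 < a i.

Implicit Types (i j : I) (A B : {set I}) (F : {set {set I}}) (d e : nat).

Definition ppow (f : I -> nat) := \prod_i p i ^ f i.

Definition radical A := \prod_(i in A) p i.

Definition support d : {set I} := [set i | p i %| d].

Local Notation N := (ppow a).

Lemma ppow_gt0 f : 0 < ppow f.
Proof. by apply: prodn_gt0 => i; rewrite expn_gt0 prime_gt0. Qed.

Lemma logn_ppow f i : logn (p i) (ppow f) = f i.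
Proof.
rewrite logn_prod => [|j]; last by rewrite expn_gt0 prime_gt0.
rewrite (bigD1 i) //= pfactorK // big1 ?addn0 // => j ji.
by rewrite lognX logn_prime // (inj_eq p_inj) eq_sym (negPf ji) muln0.
Qed.

Lemma prime_dvd_ppow q f : prime q -> q %| ppow f -> exists i, q = p i.
Proof.
move=> q_pr; rewrite /ppow.
elim/big_ind: _ => [|x y IHx IHy|i _]; first by rewrite Euclid_dvd1.
  by rewrite Euclid_dvdM // => /orP[/IHx|/IHy].
rewrite Euclid_dvdX // dvdn_prime2 // => /andP[/eqP -> _].
by exists i.
Qed.

Lemma ppow_logn f d : d %| ppow f -> d = ppow (fun i => logn (p i) d).
Proof.
move=> d_dvd; have d_gt0 := dvdn_gt0 (ppow_gt0 f) d_dvd.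
set g := fun i => _; apply: eqn_from_log => // [|q]; first exact: ppow_gt0.
have [[i ->]|nqp] : (exists i, q = p i) \/ ~ exists i, q = p i.
- case: (pickP (fun i => q == p i)) => [i /eqP ->|nq]; first by left; exists i.
  by right => -[i /eqP]; rewrite nq.
- by rewrite logn_ppow.
have log0 e h : e %| ppow h -> logn q e = 0.
  move=> e_dvd; rewrite lognE; case: and3P => // -[q_pr _ qe].
  by case: nqp; apply: prime_dvd_ppow (dvdn_trans qe e_dvd).
by rewrite (log0 d f) // (log0 _ g).
Qed.

Lemma ppow_dvd f g : (forall i, f i <= g i) -> ppow f %| ppow g.
Proof.
move=> fg; rewrite /ppow; elim/big_ind2: _ => // [x1 x2 y1 y2|i _].
  exact: dvdn_mul.
exact: dvdn_exp2l.
Qed.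

Lemma radicalE A : radical A = ppow (fun i => i \in A).
Proof.
rewrite /radical big_mkcond; apply: eq_bigr => i _.
by case: (i \in A); rewrite ?expn1.
Qed.

Lemma in_support d i : 0 < d -> (i \in support d) = (0 < logn (p i) d).
Proof. by move=> d_gt0; rewrite inE -(pfactor_dvdn 1) // expn1. Qed.

Lemma support_ppow f : support (ppow f) = [set i | 0 < f i].
Proof.
by apply/setP => i; rewrite in_support ?ppow_gt0 // logn_ppow inE.
Qed.

Lemma support_radical A : support (radical A) = A.
Proof. by rewrite radicalE support_ppow; apply/setP => i; rewrite inE lt0b. Qed.

Lemma mem_radical A : radical A \in divisors N.
Proof.
rewrite -dvdn_divisors ?ppow_gt0 // radicalE; apply: ppow_dvd => i.
exact: leq_trans (leq_b1 _) (a_gt0 i).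
Qed.

Lemma support_dvd d e : d %| e -> support d \subset support e.
Proof. by move=> de; apply/subsetP => i; rewrite !inE => /dvdn_trans ->. Qed.

Lemma radical_dvd A d : d \in divisors N ->
  (radical A %| d) = (A \subset support d).
Proof.
rewrite -dvdn_divisors ?ppow_gt0 // => dN.
have d_gt0 := dvdn_gt0 (ppow_gt0 a) dN.
apply/idP/idP => [/support_dvd|/subsetP sub]; first by rewrite support_radical.
rewrite (ppow_logn dN) radicalE; apply: ppow_dvd => i.
by case: (boolP (i \in A)) => // /sub; rewrite in_support.
Qed.

Lemma coprime_support d e : d \in divisors N -> e \in divisors N ->
  coprime d e = [disjoint support d & support e].
Proof.
rewrite -!dvdn_divisors ?ppow_gt0 // => dN eN.
have d_gt0 := dvdn_gt0 (ppow_gt0 a) dN.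
have e_gt0 := dvdn_gt0 (ppow_gt0 a) eN.
rewrite coprime_has_primes //; apply/idP/idP.
  move=> co; apply/pred0P => i /=; apply/negP; rewrite !inE => /andP[id ie].
  by case/hasP: co; exists (p i); rewrite /= mem_primes p_prime ?d_gt0 ?e_gt0.
move=> dis; apply/hasP => -[q]; rewrite /= !mem_primes.
move=> /and3P[q_pr _ qe] /and3P[_ _ qd].
have [i qi] := prime_dvd_ppow q_pr (dvdn_trans qd dN).
by move/pred0P: dis => /(_ i); rewrite /= !inE -qi qd qe.
Qed.

Definition divisors_on F : {fset nat} :=
  [fset d in divisors N | support d \in F]%fset.

Lemma in_divisors_on F d :
  (d \in divisors_on F) = (d \in divisors N) && (support d \in F).
Proof. by rewrite !inE. Qed.

Lemma radical_divisors_on F A : (radical A \in divisors_on F) = (A \in F).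
Proof. by rewrite in_divisors_on mem_radical support_radical. Qed.

Local Notation exponents := {dffun forall i, 'I_(a i).+1}.

(** An exponent is free among [a i] nonzero values at each [i] in [A] and is 0 elsewhere. *)
Lemma card_exponents A :
  #|[pred g : exponents | support (ppow (fun i => g i)) == A]| =
  weight a set0 A.
Proof.
transitivity #|(family (fun i => [pred x : 'I_(a i).+1 | (0 < x) == (i \in A)])
                : simpl_pred exponents)|.
  apply: eq_card => g; rewrite !inE support_ppow.
  apply/eqP/familyP => [<- i|gA]; first by rewrite !inE.
  by apply/setP => i; have := gA i; rewrite !inE => /eqP.
rewrite card_family foldrE big_map big_enum /=; apply: eq_bigr => i _.
rewrite inE addbF; case: (i \in A).
  transitivity #|predC1 (ord0 : 'I_(a i).+1)|; last by rewrite cardC1 card_ord.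
  by apply: eq_card => x; rewrite [LHS]eqb_id inE lt0n.
transitivity #|pred1 (ord0 : 'I_(a i).+1)|; last by rewrite card1.
by apply: eq_card => -[[|m] ltm].
Qed.

(** By unique factorization the divisors correspond to exponent vectors, which are then counted
    support by support. *)
Lemma card_divisors_on F : #|` divisors_on F| = mass a set0 F.
Proof.
pose e (g : exponents) := ppow (fun i => g i).
have e_inj : injective e.
  move=> g h eq_gh; apply/ffunP => i; apply: val_inj.
  by rewrite /= -(logn_ppow (fun i => g i)) -/(e g) eq_gh logn_ppow.
pose X := [pred g : exponents | support (e g) \in F].
transitivity #|X|.
  rewrite cardE -(size_map e); apply/perm_size/uniq_perm.
  - exact: fset_uniq.
  - by rewrite map_inj_uniq ?enum_uniq.
  move=> d; rewrite in_divisors_on; apply/andP/mapP.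
    case; rewrite -dvdn_divisors ?ppow_gt0 // => dN dF.
    pose g : exponents := [ffun i => inord (logn (p i) d)].
    have dE : d = e g.
      rewrite (ppow_logn dN); apply: eq_bigr => i _; rewrite ffunE inordK //.
      by rewrite ltnS -[X in _ <= X](logn_ppow a) dvdn_leq_log ?ppow_gt0.
    by exists g; rewrite // mem_enum inE -dE.
  case=> g; rewrite mem_enum inE => gF ->; split=> //.
  rewrite -dvdn_divisors ?ppow_gt0 //; apply: ppow_dvd => i.
  by rewrite -ltnS.
rewrite -sum1_card (partition_big (fun g => support (e g)) (mem F)) //=.
apply: eq_bigr => A AF; rewrite -card_exponents -sum1_card.
apply: eq_bigl => g; rewrite !inE.
by case: eqP => [->|]; rewrite ?AF ?andbF.
Qed.

(** * Maximal N-sets and self-dual upsets *)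

Lemma disjoint_setC A B : [disjoint A & ~: B] = (A \subset B).
Proof. by rewrite disjoints_subset setCK. Qed.

(** By maximality a divisor lies in [D] as soon as its support meets that of every member, a
    condition on supports that is closed upwards. The index set must be nonempty: for [N = 1] the
    empty set is maximal, yet no family on an empty [I] is self-dual. *)
Lemma maximal_NsetP D : 0 < #|I| -> maximal_Nset N D ->
  exists F, [/\ upset F, self_dual F & D = divisors_on F].
Proof.
move=> /card_gt0P[i0 _] [[subD coD] maxD].
have meetD : {in D &, forall d e, ~~ [disjoint support d & support e]}.
  by move=> d e dD eD; rewrite -coprime_support ?subD // coD.
have memD d : d \in divisors N -> support d != set0 ->
    (forall e, e \in D -> ~~ [disjoint support d & support e]) -> d \in D.
  move=> dN d1 meet; apply/idPn => dD; apply: (maxD _ dN dD); split.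
    by move=> e; rewrite !inE => /orP[/eqP ->|/subD].
  move=> x y; rewrite !inE => /orP[/eqP ->|xD] /orP[/eqP ->|yD].
  - by rewrite coprime_support // -setI_eq0 setIid.
  - by rewrite coprime_support ?meet // subD.
  - by rewrite coprime_sym coprime_support ?meet // subD.
  - exact: coD.
(* If [D] were empty, the prime [p i0] could be added. A member is needed so that meeting all
   members rules out the empty support. *)
have [e0 e0D] : exists e, e \in D.
  have [D0|[e eD]] := fset_0Vmem D; last by exists e.
  exists (radical [set i0]); apply: memD; rewrite ?mem_radical //.
    by rewrite support_radical; apply/set0Pn; exists i0; rewrite inE.
  by move=> e; rewrite D0 inE.
have inD d : d \in divisors N ->
    reflect (forall e, e \in D -> ~~ [disjoint support d & support e])
      (d \in D).
  move=> dN; apply: (iffP idP) => [dD e eD|meet]; first exact: meetD.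
  apply: memD => //; apply: contra (meet _ e0D) => /eqP ->.
  by rewrite -setI_eq0 set0I.
pose F := [set A | radical A \in D].
have DF : D = divisors_on F.
  apply/fsetP => d; rewrite in_divisors_on inE.
  have [dN|dN] := boolP (d \in divisors N); last exact: contraNF (@subD d) dN.
  by apply/inD/(inD _ (mem_radical _)) => //; rewrite support_radical.
have upF : upset F.
  move=> A B; rewrite !inE => /(inD _ (mem_radical _)) AF AB.
  apply/inD; rewrite ?mem_radical // => e /AF.
  by rewrite !support_radical; apply: contra; apply: disjointWl.
exists F; split=> // A; apply/idP/idP => [cAF|]; rewrite !inE.
  apply/negP => AD; move: cAF; rewrite inE => /meetD /(_ AD).
  by rewrite !support_radical -setI_eq0 setIC setICr eqxx.
(* A non-member [A] misses the support of some [e] in [D]; the complement of [A] contains that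
   support and so meets all the others. *)
move=> nAD; have [e eD disj] : exists2 e, e \in D & [disjoint A & support e].
  have [/hasP[e eD disj]|/hasPn meet] :=
    boolP (has (fun e => [disjoint A & support e]) D); first by exists e.
  case/negP: nAD; apply/inD; rewrite ?mem_radical // => e eD.
  by rewrite support_radical meet.
apply/inD; rewrite ?mem_radical // => e' e'D; rewrite support_radical.
apply: contra (meetD _ _ eD e'D); apply: disjointWl.
by rewrite -disjoints_subset disjoint_sym.
Qed.

(** A missing divisor is coprime to the radical of the complement of its support, which is present
    by self-duality. *)
Lemma maximal_divisors_on F : upset F -> self_dual F ->
  maximal_Nset N (divisors_on F).
Proof.
move=> upF dualF.
have meetF A B : A \in F -> B \in F -> ~~ [disjoint A & B].
  move=> AF BF; apply/negP.
  rewrite disjoint_sym disjoints_subset => /(upF _ _ BF).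
  by rewrite dualF AF.
split.
  split=> [d|d e]; rewrite !in_divisors_on; first by case/andP.
  by move=> /andP[dN dF] /andP[eN eF]; rewrite coprime_support // meetF.
move=> d dN dD [_ coD].
have cF : ~: support d \in F.
  by rewrite dualF; move: dD; rewrite in_divisors_on dN.
have := coD d (radical (~: support d)).
rewrite !inE eqxx mem_radical support_radical cF orbT => /(_ isT isT) /negP[].
by rewrite coprime_support ?mem_radical // support_radical disjoint_setC.
Qed.

(** * Generating sets; [U] marks the primes of exponent 1 *)

Variable U : pred I.
Hypothesis U_a : forall i, (1 < a i) = ~~ U i.

Local Notation M := (\prod_(i | U i) p i).

Lemma prod_U_radical : M = radical [set i | U i].
Proof. by apply: eq_bigl => i; rewrite inE. Qed.

Lemma radical_dvd_prod_U A :
  (radical A \in divisors M) = (A \subset [set i | U i]).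
Proof.
rewrite prod_U_radical -dvdn_divisors; last by rewrite radicalE ppow_gt0.
by rewrite radical_dvd ?mem_radical // support_radical.
Qed.

Lemma divisors_prod_U t : t \in divisors M ->
  exists2 A, t = radical A & A \subset [set i | U i].
Proof.
move=> tM; exists (support t); last first.
  rewrite -[[set i | U i]]support_radical -prod_U_radical support_dvd //.
  by rewrite dvdn_divisors // prod_U_radical radicalE ppow_gt0.
move: tM; rewrite prod_U_radical radicalE -dvdn_divisors ?ppow_gt0 // => tM.
have t_gt0 := dvdn_gt0 (ppow_gt0 _) tM.
rewrite radicalE {1}(ppow_logn tM); apply: eq_bigr => i _; congr (_ ^ _).
rewrite in_support //.
have := dvdn_leq_log (p i) (ppow_gt0 _) tM; rewrite logn_ppow.
by case: logn => [|[|m]] //; case: (i \in _).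
Qed.

Definition heavy_toggle_closed F := forall i, 1 < a i -> toggle_closed F i.

(** [F] is the upset generated by the supports of [T]. Condition (a) keeps a set and its complement
    from both lying in [F], and (c) puts one of them there. *)
Lemma R_generating T : generating_set M T ->
  exists F, [/\ upset F, self_dual F, heavy_toggle_closed F
             & R T N = divisors_on F].
Proof.
case=> subT coT _ covT.
pose F := [set A : {set I} | has (fun t => support t \subset A) T].
have inF A : reflect (exists2 t, t \in T & support t \subset A) (A \in F).
  by rewrite inE; apply: hasP.
have TN t : t \in T -> t \in divisors N.
  by move=> /subT /divisors_prod_U[A -> _]; exact: mem_radical.
exists F; split.
- move=> A B /inF[t tT tA] AB; apply/inF; exists t => //.
  exact: subset_trans tA AB.
- move=> A; apply/idP/idP => [/inF[t tT tA]|nAF].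
    apply/negP => /inF[s sT sA]; have /negP[] := coT _ _ sT tT.
    rewrite coprime_support ?TN // disjoints_subset.
    by rewrite (subset_trans sA) // subsetC.
  (* Condition (c) speaks of divisors of [M] only, so [A] is cut down to [U]; this loses nothing, as
     the supports of [T] lie in [U]. *)
  have := covT (radical (A :&: [set i | U i])).
  rewrite radical_dvd_prod_U subsetIr => /(_ isT) [[t tT]|[t tT]].
    have [B tB BU] := divisors_prod_U (subT _ tT).
    rewrite coprime_support ?mem_radical ?TN // support_radical => dis.
    apply/inF; exists t => //; move: dis; rewrite tB support_radical.
    rewrite disjoint_sym disjoints_subset => /subsetP dis.
    apply/subsetP => i iB; have := dis i iB; rewrite !inE negb_and.
    by have := subsetP BU i iB; rewrite inE => ->; rewrite orbF.
  move=> /support_dvd; rewrite support_radical subsetI => /andP[tA _].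
  by case/negP: nAF; apply/inF; exists t.
- move=> i ai A /inF[t tT tA]; apply/inF; exists t => //.
  have [B tB BU] := divisors_prod_U (subT _ tT).
  move: tA; rewrite tB support_radical => /subsetP BA.
  apply/subsetP => j jB; rewrite inE (BA j jB).
  have := subsetP BU j jB; rewrite inE; case: eqP => // -> Ui.
  by move: ai; rewrite U_a Ui.
apply/fsetP => d; rewrite in_divisors_on /R !inE /=.
have [dN|//] := boolP (d \in divisors N); rewrite /=.
apply: eq_in_has => t /subT /divisors_prod_U[A -> _].
by rewrite radical_dvd // support_radical.
Qed.

Lemma divisors_on_generating F :
  upset F -> self_dual F -> heavy_toggle_closed F ->
  exists T, generating_set M T /\ divisors_on F = R T N.
Proof.
move=> upF dualF closedF.
pose G := [set A | minset (mem F) A].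
pose T := [fset radical A | A in G]%fset.
have inG A : A \in G -> A \in F by rewrite inE => /minsetp.
have GU A : A \in G -> A \subset [set i | U i].
  (* A minimal member contains no prime of exponent above 1, since closure under toggling would
     allow its removal. *)
  rewrite inE => mA; apply/subsetP => i iA; rewrite inE -[U i]negbK -U_a.
  apply/negP => ai; have := closedF i ai A (minsetp mA).
  rewrite toggle_in // => AiF; have := minsetinf mA AiF (subD1set _ _).
  by move=> eqA; move: iA; rewrite -eqA !inE eqxx.
have ex_G A : A \in F -> exists2 B, B \in G & B \subset A.
  move=> AF; have [B mB BA] := minset_exists (P := mem F) AF.
  by exists B; rewrite ?inE.
have [_ coF] := (maximal_divisors_on upF dualF).1.
have inT t : reflect (exists2 A, A \in G & t = radical A) (t \in T).
  by apply: (iffP (imfsetP _ _ _ _)) => -[A AG ->]; exists A.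
exists T; split; first split.
- by move=> t /inT[A AG ->]; rewrite radical_dvd_prod_U GU.
- move=> s t /inT[A AG ->] /inT[B BG ->].
  by apply: coF; rewrite radical_divisors_on inG.
- move=> s t /inT[A AG ->] /inT[B BG ->]; apply: contra.
  rewrite radical_dvd ?mem_radical // support_radical => AB.
  by move: BG; rewrite inE => mB; rewrite (minsetinf mB (inG _ AG) AB).
- move=> d /divisors_prod_U[A -> _]; have [AF|nAF] := boolP (A \in F).
    have [B BG BA] := ex_G A AF.
    right; exists (radical B); first by apply/inT; exists B.
    by rewrite radical_dvd ?mem_radical // support_radical.
  have [|B BG BA] := ex_G (~: A); first by rewrite dualF.
  left; exists (radical B); first by apply/inT; exists B.
  rewrite coprime_support ?mem_radical // !support_radical.
  by rewrite disjoint_sym disjoints_subset.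
apply/fsetP => d; rewrite in_divisors_on /R !inE /=.
have [dN|//] := boolP (d \in divisors N); rewrite /=.
apply/idP/hasP => [/ex_G[B BG Bd]|[t /inT[B BG ->]]].
  by exists (radical B); rewrite ?radical_dvd //; apply/inT; exists B.
by rewrite radical_dvd //; apply: upF (inG _ BG).
Qed.

Lemma min_size_maximal_NsetP D i0 : U i0 ->
  min_size_maximal_Nset N D <-> exists T, generating_set M T /\ D = R T N.
Proof.
move=> Ui0; have I_gt0 : 0 < #|I| by apply/card_gt0P; exists i0.
split=> [[maxD minD]|[T [genT ->]]].
  have [F [upF dualF DF]] := maximal_NsetP I_gt0 maxD.
  (* The multiples of [p i0] form a maximal N-set with exactly half of the divisors, so a set of
     minimum size attains the lower bound. *)
  pose F0 := [set A : {set I} | i0 \in A].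
  have upF0 : upset F0 by move=> A B; rewrite !inE => iA /subsetP; apply.
  have dualF0 : self_dual F0 by move=> A; rewrite !inE.
  have closedF0 : heavy_toggle_closed F0.
    move=> i ai A; rewrite !inE => ->.
    by case: eqP => // ii; move: ai; rewrite U_a -ii Ui0.
  rewrite DF; apply: divisors_on_generating => //; apply/mass_eq_half => //.
  apply/eqP; rewrite eqn_leq mass_ge_half //.
  rewrite (mass_eq_half a_gt0 upF0 dualF0).2 // leq_mul2l /=.
  by rewrite -!card_divisors_on -DF; apply/minD/maximal_divisors_on.
have [F [upF dualF closedF ->]] := R_generating genT.
split; first exact: maximal_divisors_on.
move=> E /(maximal_NsetP I_gt0)[G [upG dualG ->]].
rewrite !card_divisors_on -(leq_pmul2l (ltn0Sn 1)).
by rewrite -(mass_eq_half a_gt0 upF dualF).2 // mass_ge_half.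
Qed.

End Supports.

Theorem theorem3 (n u : nat) (p alpha : 'I_n -> nat)
  (p_prime : forall i : 'I_n, prime (p i))
  (p_inj : injective p)
  (u_lt_n : u < n)
  (alpha_noninc : forall i j : 'I_n, i <= j -> alpha j <= alpha i)
  (alpha_gt1 : forall i : 'I_n, i < u -> 1 < alpha i)
  (alpha_eq1 : forall i : 'I_n, u <= i -> alpha i = 1) :
  let N := \prod_(i < n) p i ^ alpha i in
  let M := \prod_(i < n | u <= i) p i in
  forall D : {fset nat},
    min_size_maximal_Nset N D <->
    (exists T : {fset nat}, generating_set M T /\ D = R T N).
Proof.
move=> N M D.
have alphaE i : (1 < alpha i) = ~~ (u <= i).
  by case: (leqP u i) => [/alpha_eq1 ->|/alpha_gt1].
have alpha_gt0 i : 0 < alpha i.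
  by case: (leqP u i) => [/alpha_eq1 ->|/alpha_gt1/ltnW].
(* The required prime of exponent 1 is the one of index [u], which exists as [u < n]. *)
exact: (min_size_maximal_NsetP p_prime p_inj alpha_gt0 alphaE
          D (leqnn u : u <= Ordinal u_lt_n)).
Qed.
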